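(* Let $V$ be a topological vector space over the discrete field $k$, with linear topology. Then $V$ has a codimension topology (that is, the topology of $V$ is the $\kappa$-codimension topology for some cardinal $\kappa$ with $\kappa = 1$ or $\kappa \geqslant \aleph_0$) if and only if $\mathrm{Aut}(V) = \mathrm{CAut}(V)$.
   Context: Fix a field $k$ with the discrete topology; all vector spaces are over $k$. A topological vector space is a $k$-vector space with a topology for which addition and scalar multiplication $k\times V\to V$ are continuous (no Hausdorff assumption). It has linear topology if the neighborhood filter of $0$ is generated by open vector subspaces. For a vector subspace $W$ of $V$ (possibly $W=V$), $\mathrm{codim}\, W = \dim V/W$, a cardinal. For a cardinal $\kappa$ with $\kappa=1$ or $\kappa\geqslant\aleph_0$, the $\kappa$-codimension topology on $V$ is the vector space topology whose neighborhood filter of $0$ is generated by the set of all vector subspaces $W$ of $V$ with $\mathrm{codim}\, W<\kappa$. $\mathrm{Aut}(V)$ is the set of all algebraic (linear, bijective) automorphisms of $V$, and $\mathrm{CAut}(V)$ is the subset of those that are continuous. *)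

(* Defs.v *)
From HB Require Import structures.
From mathcomp Require Import all_boot all_algebra generic_quotient ring_quotient.
From mathcomp Require Import boolp classical_sets functions cardinality filter.
From mathcomp Require Import topology.

Set Implicit Arguments.
Unset Strict Implicit.
Unset Printing Implicit Defensive.

Import GRing.Theory.

Local Open Scope classical_set_scope.
Local Open Scope card_scope.
Local Open Scope quotient_scope.
Local Open Scope ring_scope.

(* The scalar field is an arbitrary field carrying the discrete topology, so    *)
(* topologicalLmodType, whose scalars form a numDomainType with the topology    *)
(* of its norm, does not apply.                                                 *)
HB.mixin Record isDiscreteTvs (k : fieldType) (V : Type)
    & Topological V & GRing.Lmodule k V := {
  tvs_add_continuous : continuous (fun x : V * V => x.1 + x.2) ;
  tvs_scale_continuous :
    continuous (fun z : discrete_topology k * V => (z.1 : k) *: z.2)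
}.

#[short(type="discreteTvsType")]
HB.structure Definition DiscreteTvs (k : fieldType) :=
  {V of Topological V & GRing.Lmodule k V & isDiscreteTvs k V}.

Section QuotSpace.
Variables (k : fieldType) (V : lmodType k) (W : submodClosed V).

(* [submodClosed] is stated over semirings and hence does not inherit from      *)
(* [zmodClosed], which the library quotient requires.                           *)
Definition subspace_pred : {pred V} := mem W.

Fact subspace_pred_zmod_closed : zmod_closed subspace_pred.
Proof. exact: GRing.submod_closedB (submodClosedP W). Qed.

HB.instance Definition _ :=
  GRing.isZmodClosed.Build V subspace_pred subspace_pred_zmod_closed.

Definition quot_space := Quotient.quot subspace_pred.

HB.instance Definition _ :=
  ZmodQuotient.copy quot_space (Quotient.quot subspace_pred).

Fact quot_space_eqE (x y : V) : (x == y %[mod quot_space]) = (x - y \in W).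
Proof. by rewrite -(Quotient.idealrBE subspace_pred). Qed.

Definition quot_scale (a : k) (x : quot_space) : quot_space :=
  \pi_quot_space (a *: repr x).

Fact pi_quot_scale (a : k) (v : V) :
  quot_scale a (\pi_quot_space v) = \pi_quot_space (a *: v).
Proof.
apply/eqP; rewrite quot_space_eqE -scalerBr rpredZ //.
by rewrite -quot_space_eqE reprK.
Qed.

Fact quot_scaleA (a b : k) (x : quot_space) :
  quot_scale a (quot_scale b x) = quot_scale (a * b) x.
Proof. by rewrite [X in quot_scale a X]/quot_scale pi_quot_scale scalerA. Qed.

Fact quot_scale1 : left_id 1 quot_scale.
Proof. by move=> x; rewrite /quot_scale scale1r reprK. Qed.

Fact quot_scaleDr : right_distributive quot_scale +%R.
Proof.
move=> a x y; rewrite -[x]reprK -[y]reprK -raddfD !pi_quot_scale.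
by rewrite scalerDr raddfD.
Qed.

Fact quot_scaleDl (x : quot_space) :
  {morph quot_scale^~ x : a b / a + b >-> a + b}.
Proof. by move=> a b; rewrite /quot_scale scalerDl raddfD. Qed.

HB.instance Definition _ := GRing.Zmodule_isLmodule.Build k quot_space
  quot_scaleA quot_scale1 quot_scaleDr quot_scaleDl.

Fact pi_quot_scalable : scalable (\pi_quot_space : V -> quot_space).
Proof. by move=> a v; rewrite -pi_quot_scale. Qed.

End QuotSpace.

Section Dimension.
Variables (k : fieldType) (U : lmodType k).

Definition lin_indep (B : set U) := forall (s : seq U) (c : U -> k),
  uniq s -> [set` s] `<=` B ->
  \sum_(u <- s) c u *: u = 0 -> forall u, u \in s -> c u = 0.

Definition spanning (B : set U) := forall v : U, exists (s : seq U) (c : U -> k),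
  [set` s] `<=` B /\ v = \sum_(u <- s) c u *: u.

Definition is_basis (B : set U) := lin_indep B /\ spanning B.

(* A cardinal is represented by a type [K] of that cardinality. *)
Definition dim_lt (K : Type) := exists B : set U,
  is_basis B /\ B #<= [set: K] /\ ~ ([set: K] #<= B).

End Dimension.

Definition codim_lt (k : fieldType) (V : lmodType k) (W : submodClosed V)
  (K : Type) := dim_lt (quot_space W) K.

Section LinearTopologies.
Variables (k : fieldType) (V : discreteTvsType k).

Definition generated_by_subspaces (P : submodClosed V -> Prop) :=
  nbhs (0 : V) = smallest Filter [set [set` W] | W in P].

Definition linear_topology :=
  generated_by_subspaces (fun W => open [set` W]).

(* A vector space topology is determined by the neighborhood filter of 0. *)
Definition is_codim_topology (K : Type) :=
  generated_by_subspaces (fun W => codim_lt W K).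

Definition has_codim_topology := exists K : Type,
  ([set: K] #= [set: unit] \/ [set: nat] #<= [set: K]) /\ is_codim_topology K.

Definition Aut := [set f : {linear V -> V} | bijective f].

Definition CAut := [set f : {linear V -> V} | Aut f /\ continuous f].

End LinearTopologies.

Arguments linear_topology {k} V.
Arguments is_codim_topology {k} V K.
Arguments has_codim_topology {k} V.
Arguments Aut {k} V.
Arguments CAut {k} V.

(* Main.v *)
(* If V carries the kappa-codimension topology, every automorphism permutes   *)
(* the subspaces of codimension < kappa and is therefore continuous.          *)
(* Conversely, let all automorphisms be continuous. If g is an endomorphism   *)
(* with g^2 = 0, then id + g is an automorphism, so for W open the subspace   *)
(* g^-1(W), which contains the intersection of W with (id+g)^-1(W), is open.  *)
(* With g of rank one this makes all subspaces of finite codimension open as  *)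
(* soon as some proper subspace is; with two such g whose images lie in       *)
(* disjoint parts of a basis of V modulo W, it makes every W' with codim W'   *)
(* <= codim W open, when codim W' is infinite. So the open subspaces are      *)
(* those of codimension < kappa, where kappa is the least infinite cardinal   *)
(* exceeding the codimensions of all open subspaces (and kappa = 1 if only V  *)
(* is open).                                                                  *)
Require Import Defs.
From HB Require Import structures.
From mathcomp Require Import all_boot all_algebra generic_quotient.
From mathcomp Require Import boolp classical_sets functions cardinality filter.
From mathcomp Require Import topology.

Set Implicit Arguments.
Unset Strict Implicit.
Unset Printing Implicit Defensive.

Import GRing.Theory.

Local Open Scope classical_set_scope.
Local Open Scope card_scope.
Local Open Scope quotient_scope.
Local Open Scope ring_scope.

(** Continuity of a linear map is tested on neighborhoods of 0. In a codimension topology, an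
    inverse automorphism carries a basis modulo [W] to a basis modulo the preimage of [W], so the
    generating subspaces are permuted ([nbhs0_preimage_codim]).

    For the converse, linearity of the topology reduces the claim to identifying the open subspaces
    ([is_codim_topology_open]). Square-zero endomorphisms [g] yield the automorphisms [id + g],
    hence new neighborhoods of 0 ([nbhs0_preimage_square_zero]). Coordinate functionals then handle
    finite codimension ([nbhs0_finite_codim]), and two endomorphisms that move basis vectors into
    disjoint halves of a basis handle infinite codimension ([nbhs0_infinite_codim]). The cardinal is
    a minimum, supplied by [card_le_min]; [card_le_total] and [infinite_setX_nat] provide the
    remaining cardinal arithmetic. *)

(** * Comparison of cardinals by Zorn's lemma *)

Lemma inj_on_card_le (T U : Type) (A : set T) (B : set U) (f : T -> U) :
  (forall x, A x -> B (f x)) ->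
  (forall x y, A x -> A y -> f x = f y -> x = y) -> A #<= B.
Proof.
move=> fAB finj; have /injfunPex/unsquash : exists2 f, set_fun A B f & set_inj A f.
  by exists f => // x y /set_mem Ax /set_mem Ay; exact: finj.
exact: inj_card_le.
Qed.

Lemma card_le_inj_on (T : Type) (U : Type) (A : set T) (B : set U) (u0 : U) :
  A #<= B -> exists f : T -> U, (forall x, A x -> B (f x)) /\
    (forall x y, A x -> A y -> f x = f y -> x = y).
Proof.
move=> /card_leP/unsquash f.
pose g x := if pselect (A x) is left Ax then val (f (SigSub (mem_set Ax))) else u0.
exists g; split=> [x Ax|x y Ax Ay]; rewrite /g.
  by case: pselect => // Ax'; exact/set_mem/valP.
case: pselect => // Ax'; case: pselect => // Ay' /val_inj.
by move=> /(@inj _ _ _ f) => /(_ (mem_set I) (mem_set I)) [].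
Qed.

(** [r] is not assumed reflexive: the instance [r x x] encodes a condition on each single member, so
    that one use of Zorn's lemma serves both families of functions below. *)
Lemma maximal_clique (T : Type) (r : T -> T -> Prop) :
  exists F : set T, (forall x y, F x -> F y -> r x y) /\
    forall z, r z z -> (forall x, F x -> r x z /\ r z x) -> F z.
Proof.
have /Zorn_bigcup[F [Fr Fmax]] : forall C : set (set T),
    C `<=` [set F | forall x y, F x -> F y -> r x y] ->
    total_on C subset -> forall x y, (\bigcup_(X in C) X) x ->
      (\bigcup_(X in C) X) y -> r x y.
  move=> C Cr Ctot x y [X CX Xx] [Y CY Yy].
  have [XY|YX] := Ctot _ _ CX CY; first by apply: (Cr Y) => //; exact: XY.
  by apply: (Cr X) => //; exact: YX.
exists F; split=> // z rzz rz; apply: contrapT => nFz.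
apply: (Fmax (F `|` [set z])).
  by split=> [|/(_ z (or_intror erefl))//]; exact: subsetUl.
move=> x y [Fx|->] [Fy|->] //; first exact: Fr.
- by have [] := rz x Fx.
- by have [] := rz y Fy.
Qed.

(* A maximal set of choice functions pairwise distinct at every coordinate  *)
(* projects onto some [S i], since otherwise it could be extended.          *)
Lemma card_le_min (I : Type) (i0 : I) (X : Type) (S : I -> set X) :
  exists i, forall j, S i #<= S j.
Proof.
have [F [Fr Fmax]] := maximal_clique (fun f g : I -> X =>
  (forall i, S i (f i)) /\ forall i, f i = g i -> f = g).
have [i Fi] : exists i, forall x, S i x -> exists2 f, F f & f i = x.
  apply: contrapT => /forallNP noF.
  have /choice[h hP] : forall i, exists x, S i x /\ forall f, F f -> f i <> x.
    move=> i; have /existsNP[x /not_implyP[Sx nx]] := noF i.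
    by exists x; split=> // f Ff fx; apply: nx; exists f.
  have Sh i : S i (h i) by have [] := hP i.
  have Fh : F h.
    apply: Fmax => // f Ff; have Sf := (Fr _ _ Ff Ff).1.
    by split; split=> // i fh; have [_ /(_ _ Ff)] := hP i; rewrite fh.
  by have [_ /(_ _ Fh)] := hP i0.
exists i => j.
have /choice[h hP] : forall x, exists y, S i x -> exists f, [/\ F f, f i = x & f j = y].
  move=> x; have [Sx|] := pselect (S i x); last by exists x.
  by have [f Ff fx] := Fi x Sx; exists (f j) => _; exists f.
apply: (inj_on_card_le (f := h)) => [x /hP[f [Ff _ <-]]|].
  exact: (Fr _ _ Ff Ff).1.
move=> x y /hP[f [Ff <- <-]] /hP[g [Fg <- <-]].
by move=> /(Fr _ _ Ff Fg).2 ->.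
Qed.

(** The two-element case of [card_le_min], with the sum type as common carrier. *)
Lemma card_le_total (T U : Type) (A : set T) (B : set U) : A #<= B \/ B #<= A.
Proof.
pose S b := if b then inl @` A else inr @` B : set (T + U).
have eA : S true #= A by apply: inj_card_eq => x y _ _ [].
have eB : S false #= B by apply: inj_card_eq => x y _ _ [].
have [[] min] := card_le_min true S; [left|right].
  by have := min false; rewrite (card_le_eql eA) (card_le_eqr eB).
by have := min true; rewrite (card_le_eql eB) (card_le_eqr eA).
Qed.

(* A maximal family of injective sequences with disjoint ranges in [A] covers *)
(* all but a finite part of [A].                                              *)
Lemma infinite_setX_nat (T : Type) (A : set T) :
  infinite_set A -> A `*` [set: nat] #<= A.
Proof.
move=> Ainf; have /infinite_setN0[a0 Aa0] := Ainf.
have [F [Fr Fmax]] := maximal_clique (fun f g : nat -> T =>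
  (forall n, A (f n)) /\ forall m n, f m = g n -> f = g /\ m = n).
pose R := [set x | A x /\ forall f n, F f -> f n <> x].
have Rfin : finite_set R.
  apply: contrapT => /infiniteP /(card_le_inj_on a0) [h [hR hinj]].
  have Fh : F h.
    apply: Fmax; first split=> [n|m n hmn].
    - by have [] := hR n I.
    - by split=> //; apply: hinj.
    move=> f Ff; have Ff' := (Fr _ _ Ff Ff).1; split; split=> [n|m n fh].
    - exact: Ff'.
    - by have [_ /(_ f m Ff)] := hR n I; rewrite fh.
    - by have [] := hR n I.
    - by have [_ /(_ f n Ff)] := hR m I; rewrite fh.
  by have [_ /(_ h 0%N Fh)] := hR 0%N I.
have [f0 Ff0] : exists f, F f.
  apply: contrapT => /forallNP nF; apply: Ainf; suff -> : A = R by [].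
  by apply/seteqP; split=> [x Ax|x []//]; split=> // f n /nF.
have /countable_injP[/= rho rho_inj] := finite_set_countable Rfin.
(* A code for [x] is a sequence with a number: twice its index if [x] lies on a sequence of [F], an
   odd number attached to [f0] if [x] is left over. Pairing this number with [n] and evaluating the
   sequence at the result embeds the product. *)
pose Q x (p : (nat -> T) * nat) := F p.1 /\
  ((exists n, p.2 = n.*2 /\ p.1 n = x) \/ R x /\ p = (f0, (rho x).*2.+1)).
have Qinj x y p : Q x p -> Q y p -> x = y.
  case: p => f n [_ /= [[m [-> <-]]|[Rx [-> ->]]]] [_ /= [[m' [mm' <-]]|[Ry]]] //.
  - by move/double_inj: mm' => ->.
  - by case=> _ /(congr1 odd); rewrite /= !odd_double.
  - by move: mm' => /(congr1 odd); rewrite /= !odd_double.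
  - by case=> /double_inj; apply: rho_inj; exact: mem_set.
have /choice[e eQ] : forall x, exists p, A x -> Q x p.
  move=> x; have [Ax|] := pselect (A x); last by exists (f0, 0%N).
  have [Rx|nRx] := pselect (R x).
    by exists (f0, (rho x).*2.+1) => _; split=> //; right.
  have /existsNP[f /existsNP[n /not_implyP[Ff /contrapT fx]]] :
    ~ forall f n, F f -> f n <> x by move=> ?; apply: nRx.
  by exists (f, n.*2) => _; split=> //; left; exists n.
apply: (inj_on_card_le (f := fun z => (e z.1).1 (pickle ((e z.1).2, z.2)))).
  by move=> [x n] [/= Ax _]; have [Fe _] := eQ x Ax; apply: (Fr _ _ Fe Fe).1.
move=> [x n] [y m] [/= Ax _] [/= Ay _].
have [[Fx _] [Fy _]] := (eQ x Ax, eQ y Ay).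
move=> /(Fr _ _ Fx Fy).2[e1 /(pcan_inj pickleK)[e2 ->]].
congr pair; apply: (Qinj _ _ (e x)); first exact: eQ.
by have := eQ y Ay; rewrite (surjective_pairing (e y)) -e1 -e2 -surjective_pairing.
Qed.

(** * Independence, span and bases modulo a subspace *)

Section IndependenceModulo.
Variables (k : fieldType) (V : lmodType k).
Implicit Types (W : submodClosed V) (A B S : set V) (s t : seq V) (c d : V -> k).

(** Working modulo [W] inside [V], rather than in the quotient, lets bases modulo different
    subspaces share vectors. *)
Definition indep_mod W B := forall s c, uniq s -> [set` s] `<=` B ->
  \sum_(u <- s) c u *: u \in W -> forall u, u \in s -> c u = 0.

Definition span_mod W B := [set v | exists s c,
  [/\ uniq s, [set` s] `<=` B & v - \sum_(u <- s) c u *: u \in W]].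

Definition basis_mod W B := indep_mod W B /\ forall v, span_mod W B v.

(** Padding with zero coefficients brings two combinations to a common list of vectors. *)
Lemma sum_extend (U : lmodType k) (phi : V -> U) s t c :
  uniq s -> uniq t -> {subset s <= t} ->
  \sum_(u <- t) (if u \in s then c u else 0) *: phi u =
  \sum_(u <- s) c u *: phi u.
Proof.
move=> us ut st; rewrite (eq_bigr (fun u => if u \in s then c u *: phi u else 0)).
  rewrite -big_mkcond -big_filter; apply: perm_big.
  apply: uniq_perm => // [|u]; first exact: filter_uniq.
  by rewrite mem_filter andb_idr //; exact: st.
by move=> u _; case: ifP => // _; rewrite scale0r.
Qed.

Lemma undup_cat_sub s t A : [set` s] `<=` A -> [set` t] `<=` A ->
  [set` undup (s ++ t)] `<=` A.
Proof.
move=> sA tA u /=; rewrite mem_undup mem_cat => /orP[] ?; [exact: sA|exact: tA].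
Qed.

Lemma span_mod_linear W B a v w :
  span_mod W B v -> span_mod W B w -> span_mod W B (a *: v + w).
Proof.
move=> [s [c [us sB vc]]] [t [d [ut tB wd]]].
pose r := undup (s ++ t); have ur : uniq r by exact: undup_uniq.
have sr : {subset s <= r} by move=> u us'; rewrite mem_undup mem_cat us'.
have tr : {subset t <= r} by move=> u ut'; rewrite mem_undup mem_cat ut' orbT.
exists r, (fun u => a * (if u \in s then c u else 0) + if u \in t then d u else 0).
split=> //; first exact: undup_cat_sub.
under eq_bigr do rewrite scalerDl -scalerA.
rewrite big_split -scaler_sumr (sum_extend idfun) // (sum_extend idfun) //=.
by rewrite opprD addrACA -scalerBr rpredD // rpredZ.
Qed.

Lemma span_mod_sub W B v : v \in W -> span_mod W B v.
Proof.
by move=> Wv; exists [::], (fun=> 0); split=> //; rewrite big_nil subr0.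
Qed.

Lemma span_mod_mem W B v : B v -> span_mod W B v.
Proof.
move=> Bv; exists [:: v], (fun=> 1); split=> //.
  by move=> u /=; rewrite inE => /eqP->.
by rewrite big_seq1 scale1r subrr rpred0.
Qed.

Lemma span_mod_sum W B s c : (forall u, u \in s -> span_mod W B u) ->
  span_mod W B (\sum_(u <- s) c u *: u).
Proof.
move=> sB; rewrite big_seq; elim/big_rec: _ => [|u v su Bv].
  by apply: span_mod_sub; rewrite rpred0.
exact/span_mod_linear/Bv/sB.
Qed.

Lemma span_mod_trans W A B v : A `<=` span_mod W B -> span_mod W A v ->
  span_mod W B v.
Proof.
move=> AB [s [c [_ sA vc]]]; rewrite -[v](subrK (\sum_(u <- s) c u *: u)).
rewrite -[v - _]scale1r; apply: span_mod_linear; first exact: span_mod_sub.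
by apply: span_mod_sum => u /sA/AB.
Qed.

Lemma span_mod_setU1 W B v : indep_mod W B -> ~ indep_mod W (v |` B) ->
  span_mod W B v.
Proof.
move=> iB /existsNP[s /existsNP[c /not_implyP[us /not_implyP[sB]]]].
move=> /not_implyP[Wc /existsNP[u0 /not_implyP[su0 /eqP cu0]]].
have rB : [set` rem v s] `<=` B.
  by move=> u /=; rewrite mem_rem_uniq // inE => /andP[/eqP uv /sB[]].
have ur : uniq (rem v s) by exact: rem_uniq.
have [sv|nsv] := boolP (v \in s); last first.
  suff : c u0 = 0 by move/eqP: cu0.
  by move: Wc su0; rewrite -(rem_id nsv) => Wc; exact: (iB _ _ ur rB Wc).
move: Wc; rewrite (big_rem v sv) /= => Wc.
have [cv0|cv0] := eqVneq (c v) 0.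
  have /eqP[] := cu0; have [->//|uv] := eqVneq u0 v.
  rewrite cv0 scale0r add0r in Wc; apply: (iB _ _ ur rB Wc).
  by rewrite mem_rem_uniq // inE uv.
exists (rem v s), (fun u => - (c v)^-1 * c u); split=> //.
under eq_bigr do rewrite -scalerA.
rewrite -scaler_sumr scaleNr opprK -[v in v + _](scale1r v) -(mulVf cv0) -scalerA.
by rewrite -scalerDr rpredZ.
Qed.

(** New vectors come only from [S]; this is what allows a basis to be adapted to a second
    subspace. *)
Lemma indep_mod_extend W A S : indep_mod W A -> exists B,
  [/\ A `<=` B, B `<=` A `|` S, indep_mod W B & S `<=` span_mod W B].
Proof.
move=> iA; pose P B := B `<=` S /\ indep_mod W (A `|` B).
have /Zorn_bigcup[B [[BS iB] Bmax]] : forall C : set (set V), C `<=` P ->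
    total_on C subset -> P (\bigcup_(X in C) X).
  move=> C CP Ctot; split=> [u [X CX Xu]|s c us sC].
    by have [XS _] := CP _ CX; exact: XS.
  (* A finite list meets only finitely many members of the chain, so one member suffices; the first
     alternative also covers the empty chain. *)
  suff [sA|[X CX sX]] : [set` s] `<=` A \/ exists2 X, C X & [set` s] `<=` A `|` X.
  - exact: iA.
  - by have [_ iX] := CP _ CX; exact: iX.
  elim: s sC {us} => [_|u s IH sC]; first by left.
  have us : [set` s] `<=` [set` u :: s] by move=> v; rewrite /= inE orbC => ->.
  have cons_sub (D : set V) : D u -> [set` s] `<=` D -> [set` u :: s] `<=` D.
    by move=> Du sD v /=; rewrite inE => /orP[/eqP->//|/sD].
  have [sA|[X CX sX]] := IH (subset_trans us sC).
    have [Au|[X CX Xu]] := sC u (mem_head _ _); first by left; exact: cons_sub.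
    by right; exists X => //; apply: cons_sub; [right|move=> v /sA; left].
  right; have [Au|[Y CY Yu]] := sC u (mem_head _ _).
    by exists X => //; apply: cons_sub => //; left.
  have [XY|YX] := Ctot _ _ CX CY.
    exists Y => //; apply: cons_sub; first by right.
    by move=> v /sX[|/XY]; [left|right].
  by exists X => //; apply: cons_sub => //; right; exact: YX.
exists (A `|` B); split=> //; first exact: setUS.
move=> v Sv; have [Bv|nBv] := pselect (B v).
  by apply: span_mod_mem; right.
apply: span_mod_setU1 => // iv; apply: (Bmax (v |` B)).
  by split=> [|/(_ v (or_introl erefl))//]; exact: subsetUr.
split; first by move=> u [->|/BS].
by rewrite setUCA.
Qed.

Lemma basis_mod_exists W : exists B, basis_mod W B.
Proof.
have i0 : indep_mod W set0 by move=> s c _ s0 _ u /s0.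
have [B [_ _ iB sB]] := indep_mod_extend setT i0.
by exists B; split=> // v; exact: sB.
Qed.

Lemma linear_extension W B (U : lmodType k) (phi : V -> U) : basis_mod W B ->
  exists g : {linear V -> U},
    (forall w, w \in W -> g w = 0) /\ forall b, B b -> g b = phi b.
Proof.
move=> [iB sB].
have /choice[s] := sB; move=> /choice[c sc].
pose r u v := if v \in s u then c u v else 0.
pose g u := \sum_(v <- s u) c u v *: phi v.
have us u : uniq (s u) by have [] := sc u.
(* The value does not depend on the chosen expansion: two expansions of [u] modulo [W], padded to a
   common list, differ by an element of [W], so independence equates their coefficients. *)
have gE u t d : uniq t -> [set` t] `<=` B -> u - \sum_(v <- t) d v *: v \in W ->
    g u = \sum_(v <- t) d v *: phi v.
  move=> ut tB td; have [_ suB uc] := sc u.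
  pose t' := undup (s u ++ t); have ut' : uniq t' by exact: undup_uniq.
  have st' : {subset s u <= t'} by move=> v uv; rewrite mem_undup mem_cat uv.
  have tt' : {subset t <= t'} by move=> v uv; rewrite mem_undup mem_cat uv orbT.
  rewrite /g -(sum_extend phi (c u) (us u) ut' st') -(sum_extend phi d ut ut' tt').
  apply: eq_big_seq => v vt'; congr (_ *: _); apply/eqP; rewrite -subr_eq0; apply/eqP.
  apply: (iB t' (fun v => (if v \in s u then c u v else 0) -
     if v \in t then d v else 0)) vt' => //; first exact: undup_cat_sub.
  under eq_bigr do rewrite scalerBl.
  rewrite sumrB (sum_extend idfun) // (sum_extend idfun) //=.
  rewrite -(subrKA u) -opprB -scaleN1r rpredD //; exact: rpredZ.
have glin : linear g.
  move=> a u w; have [_ uB uc] := sc u; have [_ wB wc] := sc w.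
  pose t := undup (s u ++ s w); have ut : uniq t by exact: undup_uniq.
  have ust : {subset s u <= t} by move=> v ?; rewrite mem_undup mem_cat; apply/orP; left.
  have wst : {subset s w <= t} by move=> v ?; rewrite mem_undup mem_cat; apply/orP; right.
  rewrite (gE _ t (fun v => a * r u v + r w v)) //.
  - under eq_bigr do rewrite scalerDl -scalerA.
    by rewrite big_split -scaler_sumr !sum_extend.
  - exact: undup_cat_sub.
  under eq_bigr do rewrite scalerDl -scalerA.
  rewrite big_split -scaler_sumr (sum_extend idfun) // (sum_extend idfun) //=.
  by rewrite opprD addrACA -scalerBr rpredD // rpredZ.
pose glM := GRing.isLinear.Build k V U _ g glin.
pose gl : {linear V -> U} := HB.pack g glM.
exists gl; split=> [w Ww|b Bb] /=.
  by rewrite /= (gE w [::] (fun=> 0)) ?big_nil ?subr0.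
rewrite (gE b [:: b] (fun=> 1)) ?big_seq1 ?scale1r ?subrr ?rpred0 //.
by move=> u /=; rewrite inE => /eqP->.
Qed.

End IndependenceModulo.

(** * Transport of bases along linear maps, and codimension *)

Lemma submod_pred_exists (k : fieldType) (V : lmodType k) (P : {pred V}) :
  submod_closed P -> exists W : submodClosed V, forall v, (v \in W) = (v \in P).
Proof.
move=> Pc; pose PM := GRing.isSubmodClosed.Build k V P Pc.
by exists (HB.pack P PM : submodClosed V).
Qed.

Lemma left_inverse_on (T U : Type) (x0 : T) (A : set T) (f : T -> U) :
  (forall x y, A x -> A y -> f x = f y -> x = y) ->
  exists g : U -> T, forall x, A x -> g (f x) = x.
Proof.
move=> finj.
have /choice[g gf] : forall z, exists x, forall y, A y -> f y = z -> x = y.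
  move=> z; have [[x Ax fx]|nx] := pselect (exists2 x, A x & f x = z).
    by exists x => y Ay fy; apply: finj; rewrite ?fx ?fy.
  by exists x0 => y Ay fy; case: nx; exists y.
by exists g => x Ax; exact: gf.
Qed.

(** [phi] is any injection on [A], not necessarily linear: the sum is merely reindexed along it. *)
Lemma indep_mod_inj (k : fieldType) (V U : lmodType k) (W : submodClosed U)
    (A : set V) (B : set U) (phi : V -> U) : indep_mod W B ->
  (forall v, A v -> B (phi v)) ->
  (forall v w, A v -> A w -> phi v = phi w -> v = w) ->
  forall s (c : V -> k), uniq s -> [set` s] `<=` A ->
    \sum_(v <- s) c v *: phi v \in W -> forall v, v \in s -> c v = 0.
Proof.
move=> iB phiB phi_inj s c us sA Wc v sv.
have [psi psiK] := left_inverse_on 0 phi_inj.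
rewrite -(psiK _ (sA _ sv)).
apply: (iB (map phi s) (c \o psi)); last exact: map_f.
- by rewrite map_inj_in_uniq // => x y /sA Ax /sA Ay; exact: phi_inj.
- by move=> _ /mapP[x /sA Ax ->]; exact: phiB.
rewrite big_map; move: Wc; congr (_ \in W).
by apply: eq_big_seq => x /sA Ax /=; rewrite psiK.
Qed.

Section BasisTransfer.
Variables (k : fieldType) (V U : lmodType k) (p : {linear V -> U}) (q : U -> V).
Variables (W : submodClosed V) (W' : submodClosed U).
Hypothesis W_preim : forall v, (v \in W) = (p v \in W').

(** Applied both to the quotient map with section [repr] and to an automorphism with its inverse. *)
Lemma basis_mod_pullback (B : set U) : cancel q p ->
  basis_mod W' B -> basis_mod W (q @` B).
Proof.
move=> qK [iB sB]; split=> [s c us sD Wc u su|v].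
  apply: (indep_mod_inj (phi := p) iB _ _ us sD _ su).
  - by move=> _ [b Bb <-]; rewrite qK.
  - by move=> _ _ [b _ <-] [b' _ <-]; rewrite !qK => ->.
  move: Wc; rewrite W_preim linear_sum; congr (_ \in W').
  by apply: eq_bigr => v _; rewrite linearZ.
have [s [c [us sB' sc]]] := sB (p v).
rewrite -[v](subrK (\sum_(y <- s) c y *: q y)) -[v - _]scale1r.
apply: span_mod_linear.
  apply: span_mod_sub; rewrite W_preim linearB linear_sum.
  by under eq_bigr do rewrite linearZ qK.
rewrite (eq_bigr (fun y => (c \o p) (q y) *: q y)); last by move=> y _ /=; rewrite qK.
rewrite -(big_map q predT (fun u => (c \o p) u *: u)); apply: span_mod_sum.
by move=> _ /mapP[y /sB' By ->]; apply: span_mod_mem; exists y.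
Qed.

Lemma basis_mod_pushforward (D : set V) : (forall y, exists x, p x = y) ->
  (forall u, D u -> q (p u) = u) -> basis_mod W D -> basis_mod W' (p @` D).
Proof.
move=> psurj qpK [iD sD]; split=> [s c us sB Wc y sy|y].
  apply: (indep_mod_inj (phi := q) iD _ _ us sB _ sy).
  - by move=> _ [u Du <-]; rewrite qpK.
  - by move=> _ _ [u Du <-] [u' Du' <-]; rewrite !qpK // => ->.
  rewrite W_preim; move: Wc; rewrite linear_sum; congr (_ \in W').
  by apply: eq_big_seq => _ /sB[u Du <-]; rewrite linearZ qpK.
have [v <-] := psurj y; have [s [c [us sD' sc]]] := sD v.
rewrite -[p v](subrK (\sum_(u <- s) c u *: p u)) -[p v - _]scale1r.
apply: span_mod_linear.
  apply: span_mod_sub; move: sc; rewrite W_preim linearB linear_sum.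
  by under eq_bigr do rewrite linearZ.
rewrite (eq_big_seq (fun y => (c \o q) (p y) *: p y)); last first.
  by move=> u /sD' Du /=; rewrite qpK.
rewrite -(big_map p predT (fun u => (c \o q) u *: u)); apply: span_mod_sum.
by move=> _ /mapP[u /sD' Du ->]; apply: span_mod_mem; exists u.
Qed.

End BasisTransfer.

Lemma is_basisP (k : fieldType) (U : lmodType k) (Z : submodClosed U) (B : set U) :
  (forall u, (u \in Z) = (u == 0)) -> is_basis B <-> basis_mod Z B.
Proof.
move=> ZE; split=> -[iB sB]; split.
- by move=> s c us sB'; rewrite ZE => /eqP; exact: iB.
- move=> v; have [s [c [sB' ->]]] := sB v.
  by apply: span_mod_sum => u /sB'; exact: span_mod_mem.
- by move=> s c us sB' s0; apply: iB => //; rewrite ZE s0.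
- move=> v; have [s [c [_ sB']]] := sB v.
  by rewrite ZE subr_eq0 => /eqP ->; exists s, c.
Qed.

Section CodimLt.
Variables (k : fieldType) (V : lmodType k).

(** Projection to the quotient is injective on a basis modulo [W], and representatives lift a basis
    back, so cardinality bounds pass both ways. *)
Lemma codim_ltP (W : submodClosed V) (K : Type) :
  codim_lt W K <->
  exists D, [/\ basis_mod W D, D #<= [set: K] & ~ ([set: K] #<= D)].
Proof.
have pi_lin : linear (\pi_(quot_space W) : V -> quot_space W).
  by move=> a u v; rewrite raddfD; congr (_ + _); exact: pi_quot_scalable.
pose piM := GRing.isLinear.Build k V (quot_space W) _ _ pi_lin.
pose p : {linear V -> quot_space W} :=
  HB.pack (\pi_(quot_space W) : V -> quot_space W) piM.
have [Z ZE] : exists Z : submodClosed (quot_space W), forall u, (u \in Z) = (u == 0).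
  apply: (@submod_pred_exists _ _ (pred1 0)).
  by split=> [|a u v]; rewrite !inE // => /eqP-> /eqP->; rewrite scaler0 addr0.
have W_preim v : (v \in W) = (p v \in Z).
  rewrite ZE -[v in LHS]subr0 -quot_space_eqE.
  by congr (_ == _); exact: (raddf0 p).
have reprK' : cancel (repr : quot_space W -> V) p by move=> x; exact: reprK.
split=> [[B [bB [BK KB]]]|[D [bD DK KD]]].
  exists (repr @` B); split.
  - by apply: (basis_mod_pullback W_preim) => //; exact/is_basisP.
  - exact: card_le_trans (card_image_le _ _) BK.
  - by move=> KD; exact/KB/(card_le_trans KD)/card_image_le.
have [iD _] := bD.
have pinj u v : D u -> D v -> p u = p v -> u = v.
  move=> Du Dv puv; apply: contrapT => /eqP uv.
  pose c w : k := if w == u then 1 else -1.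
  have : c u = 0.
    apply: (iD [:: u; v] c); rewrite /= ?inE ?eqxx ?uv //.
      by move=> w /=; rewrite !inE => /orP[] /eqP ->.
    rewrite big_cons big_seq1 /c eqxx eq_sym (negPf uv) scale1r scaleN1r.
    by rewrite W_preim ZE (linearB p) puv subrr.
  by rewrite /c eqxx => /eqP; rewrite oner_eq0.
have [q qpK] := left_inverse_on 0 pinj.
exists (p @` D); split; last split.
- apply/(is_basisP _ ZE); apply: (basis_mod_pushforward (q := q) W_preim) => //.
  by move=> y; exists (repr y); rewrite reprK'.
- exact: card_le_trans (card_image_le _ _) DK.
- move=> KpD; apply/KD/(card_le_trans KpD).
  exact: card_image_le.
Qed.

End CodimLt.

(** * Codimension topologies make all automorphisms continuous *)

Section Continuity.
Variables (k : fieldType) (V : discreteTvsType k).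
Implicit Types (W : submodClosed V) (f : {linear V -> V}).

Lemma continuous_translate (x : V) : continuous (fun v : V => v + x).
Proof.
move=> v; apply: (@cvg_comp _ _ _ (fun v => (v, x)) (fun z : V * V => z.1 + z.2) _
  (nbhs (v, x))).
  by apply: cvg_pair; [exact: cvg_id | exact: cvg_cst].
exact: (@tvs_add_continuous k V (v, x)).
Qed.

Lemma nbhs_translate0 (x : V) (A : set V) :
  nbhs (0 : V) A -> nbhs x [set v | A (v - x)].
Proof.
move=> A0; apply: (@continuous_translate (- x) x A).
by rewrite subrr.
Qed.

Lemma nbhs0_translate (x : V) (A : set V) :
  nbhs x A -> nbhs (0 : V) [set v | A (v + x)].
Proof.
move=> Ax; apply: (@continuous_translate x 0 A).
by rewrite add0r.
Qed.

Lemma nbhs0_open W : nbhs (0 : V) [set` W] -> open [set` W].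
Proof.
move=> W0; rewrite openE => x /= Wx.
apply: (@filterS V (nbhs x) _ _ _ _ (nbhs_translate0 x W0)) => y /= Wy.
by rewrite -[y](subrK x); exact: rpredD.
Qed.

Lemma nbhs0_linear_continuous f :
  (forall A, nbhs (0 : V) A -> nbhs (0 : V) (f @^-1` A)) -> continuous f.
Proof.
move=> f0 x A /nbhs0_translate/f0/nbhs_translate0.
move=> /(_ x); apply: filterS => y /=.
by rewrite raddfB subrK.
Qed.

Lemma nbhs0_preimage_codim (K : Type) f (A : set V) : is_codim_topology V K ->
  bijective f -> nbhs (0 : V) A -> nbhs (0 : V) (f @^-1` A).
Proof.
(* The sets whose preimage is a neighborhood of 0 form a filter, so by minimality of the
   neighborhood filter only its generators need checking. *)
move=> VK [g fK gK]; rewrite {1}VK => /(_ [set B | nbhs (0 : V) (f @^-1` B)]).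
apply; split.
  split=> [|B C fB fC|B C BC]; [exact: filterT | exact: filterI | apply: filterS].
  by move=> v; exact: BC.
move=> _ [W /codim_ltP[D [bD DK KD]] <-].
have [W' W'E] : exists W' : submodClosed V, forall v, (v \in W') = (f v \in W).
  apply: (@submod_pred_exists _ _ [pred v | f v \in W]).
  split=> [|a u v]; rewrite !inE ?linear0 ?rpred0 // linearP => fu fv.
  by rewrite rpredD // rpredZ.
rewrite /= VK => F [FF]; apply; exists W'.
  apply/codim_ltP; exists (g @` D); split.
  - exact: (basis_mod_pullback W'E).
  - exact: card_le_trans (card_image_le _ _) DK.
  - by move=> KgD; exact/KD/(card_le_trans KgD)/card_image_le.
by apply/seteqP; split=> v /=; rewrite W'E.
Qed.

Lemma codim_topology_Aut : has_codim_topology V -> Aut V = CAut V.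
Proof.
move=> [K [_ VK]]; apply/seteqP; split=> [f fbij|f []//]; split=> //.
by apply: nbhs0_linear_continuous => A; exact: nbhs0_preimage_codim VK fbij.
Qed.

End Continuity.

(** * Subspaces forced open by continuity of all automorphisms *)

Section AutInvariant.
Variables (k : fieldType) (V : discreteTvsType k).
Implicit Types (W : submodClosed V) (f g : {linear V -> V}).
Hypothesis Aut_nbhs0 : forall f (A : set V), bijective f ->
  nbhs (0 : V) A -> nbhs (0 : V) (f @^-1` A).

(* [id + g] is an automorphism with inverse [id - g], and [g] sends          *)
(* [W `&` (id + g) @^-1` W] into [W].                                        *)
Lemma nbhs0_preimage_square_zero W g : (forall v, g (g v) = 0) ->
  nbhs (0 : V) [set` W] -> nbhs (0 : V) [set v | g v \in W].
Proof.
move=> gg0 W0; pose h v := v + g v.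
have h_lin : linear h.
  by move=> a u v; rewrite /h linearP scalerDr addrACA.
pose hM := GRing.isLinear.Build k V V _ h h_lin.
pose f : {linear V -> V} := HB.pack h hM.
have f_bij : bijective f.
  exists (fun v => v - g v) => v /=; rewrite /h.
    by rewrite linearD gg0 addr0 addrK.
  by rewrite linearB gg0 subr0 subrK.
apply: filterS (filterI W0 (Aut_nbhs0 f_bij W0)) => v [/= Wv].
rewrite /h => Wvg; rewrite -[g v](addKr v) -scaleN1r addrC.
by rewrite rpredD // rpredZ.
Qed.

(* If no [x] outside [W] lies in the kernel of [phi], then the hyperplane    *)
(* [ker phi] is contained in the proper subspace [W], hence equal to it.     *)
Lemma nbhs0_ker W (phi : {linear V -> k^o}) (u : V) :
  nbhs (0 : V) [set` W] -> u \notin W -> nbhs (0 : V) [set v | phi v = 0].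
Proof.
move=> W0 nWu; have [[x nWx phix]|nx] := pselect (exists2 x, x \notin W & phi x = 0).
  pose g v := (phi v : k) *: x.
  have g_lin : linear g.
    by move=> a v w; rewrite /g linearP scalerDl scalerA.
  pose gM := GRing.isLinear.Build k V V _ g g_lin.
  pose gl : {linear V -> V} := HB.pack g gM.
  have gg0 v : gl (gl v) = 0 by rewrite /= /g linearZ /= phix scaler0 scale0r.
  apply: filterS (nbhs0_preimage_square_zero gg0 W0) => v /=.
  rewrite /g => Wv; apply/eqP; apply: contraNT nWx => phiv.
  by rewrite -[x]scale1r -(mulVf phiv) -scalerA rpredZ.
apply: filterS W0 => v /= Wv; apply/eqP; apply: contraNT nWu => phiv.
have : u - (phi u / phi v : k) *: v \in W.
  apply: contrapT => /negP nW; apply: nx; exists (u - (phi u / phi v : k) *: v) => //.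
  by rewrite linearB linearZ /= /GRing.scale /= divfK ?subrr.
by move=> Wu; rewrite -[u](subrK ((phi u / phi v : k) *: v)) rpredD // rpredZ.
Qed.

(** [W'] contains the common kernel of the finitely many coordinate functionals modulo [W'], and
    [nbhs0_ker] applies to each of them. *)
Lemma nbhs0_finite_codim W W' (u : V) (D : set V) :
  nbhs (0 : V) [set` W] -> u \notin W -> basis_mod W' D -> finite_set D ->
  nbhs (0 : V) [set` W'].
Proof.
move=> W0 nWu bD /finite_seqP[r Dr].
have /choice[phi phiP] : forall d : V, exists g : {linear V -> k^o},
    (forall w, w \in W' -> g w = 0) /\ forall b, D b -> g b = (b == d)%:R.
  by move=> d; exact: (linear_extension (fun b => (b == d)%:R : k^o) bD).
have : nbhs (0 : V) [set v | forall d, d \in r -> phi d v = 0].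
  elim: (r) => [|d r' IH]; first by apply: filterS filterT => v _ d.
  apply: filterS (filterI (nbhs0_ker (phi d) W0 nWu) IH) => v [/= v0 r'0] x.
  by rewrite inE => /orP[/eqP->|/r'0].
apply: filterS => v /= v0; have [s [c [us sD vc]]] := bD.2 v.
suff s0 : \sum_(x <- s) c x *: x = 0 by move: vc; rewrite s0 subr0.
rewrite big_seq big1 // => d sd; suff -> : c d = 0 by rewrite scale0r.
have [phi0 phi1] := phiP d; have := sD _ sd; rewrite Dr => /v0.
rewrite -[v](subrK (\sum_(x <- s) c x *: x)) linearD phi0 // add0r linear_sum.
rewrite (bigD1_seq d) //= linearZ phi1 ?eqxx; last exact: sD.
rewrite big1_seq ?addr0; first by move=> cd0; rewrite -[c d]mulr1; exact: cd0.
move=> x /andP[/negPf xd sx]; rewrite linearZ /= phi1 ?xd; last exact: sD.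
exact: scaler0.
Qed.

(* [C] and [D] are bases of [V] modulo [W] and [W'] sharing [C `\` A]. Each    *)
(* [g b] kills [W'] and [Cb b], and embeds the rest of [D] into [Cb b];       *)
(* hence [g b] squares to zero and, as [Cb false] and [Cb true] are disjoint, *)
(* the intersection of the two preimages of [W] lies in [W'].                 *)
Lemma nbhs0_infinite_codim W W' (D0 : set V) :
  nbhs (0 : V) [set` W] -> basis_mod W' D0 -> infinite_set D0 ->
  (forall C, basis_mod W C -> D0 #<= C) -> nbhs (0 : V) [set` W'].
Proof.
move=> W0 bD0 D0inf D0C.
have i0 : indep_mod W set0 by move=> s c _ s0 _ u /s0.
have [A [_ AW' iA W'A]] := indep_mod_extend [set` W'] i0.
have {}AW' v : A v -> v \in W' by move=> /AW'[].
have [C [AC _ iC sC]] := indep_mod_extend setT iA.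
have {}D0C : D0 #<= C by apply: D0C; split=> // v; exact: sC.
(* A relation modulo [W'] becomes one modulo [W] after subtracting a combination of [A];
   independence of [C] then applies. *)
have iE : indep_mod W' (C `\` A).
  move=> s c us sE /W'A [t [d [ut tA Wcd]]] u su.
  have st v : v \in t -> v \in s = false.
    by move=> /tA Av; apply/negP => /sE[].
  suff : (if u \in s then c u else - d u) = 0 by rewrite su.
  apply: (iC (s ++ t) (fun u => if u \in s then c u else - d u)).
  - rewrite cat_uniq us ut andbT /=; apply/hasPn => v vt /=; by rewrite st.
  - by move=> v /=; rewrite mem_cat => /orP[/sE[]|/tA/AC].
  - rewrite big_cat; move: Wcd; congr (_ \in W); congr (_ + _).
      by apply: eq_big_seq => v ->.
    by rewrite -sumrN; apply: eq_big_seq => v /st ->; rewrite scaleNr.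
  - by rewrite mem_cat su.
have [D [ED DE iD sD]] := indep_mod_extend D0 iE.
have bD : basis_mod W' D.
  by split=> // v; apply: span_mod_trans (bD0.2 v) => d; exact: sD.
have Cinf : infinite_set C by move=> /(card_le_finite D0C).
have [j [jC jinj]] := card_le_inj_on 0 (infinite_setX_nat Cinf).
have {}jinj x n y m : C x -> C y -> j (x, n) = j (y, m) -> x = y /\ n = m.
  by move=> Cx Cy /(jinj (x, n) (y, m) (conj Cx I) (conj Cy I))[-> ->].
have [h [hC hinj]] := card_le_inj_on 0 D0C.
pose Cb (b : bool) := [set v | exists x n, [/\ C x, odd n = b & v = j (x, n)]].
have CbC b v : Cb b v -> C v by move=> [x [n [Cx _ ->]]]; exact: jC.
have Cb_disj v : Cb false v -> ~ Cb true v.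
  move=> [x [n [Cx n0 ->]]] [y [m [Cy m1]]] /(jinj _ _ _ _ Cx Cy)[_ nm].
  by move: n0; rewrite nm m1.
(* The tags [b] and [b.+2] both have parity [b], so the values land in [Cb b]; being distinct, they
   keep the images of [C] without [A] and of the vectors routed through [h] apart. *)
pose phi (b : bool) v : V := if pselect (Cb b v) then 0 else
  if pselect (C v /\ ~ A v) then j (v, b : nat) else j (h v, b.+2).
have phi0 b v : Cb b v -> phi b v = 0 by move=> ?; rewrite /phi; case: pselect.
have D0E v : D v -> ~ (C v /\ ~ A v) -> D0 v by move=> /DE[].
have phiC b v : D v -> ~ Cb b v -> Cb b (phi b v).
  move=> Dv nCbv; rewrite /phi; case: (pselect (Cb b v)) => [//|/= _].
  case: pselect => /= [[Cv _]|/(D0E _ Dv)/hC Ch].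
    by exists v, b; rewrite oddb.
  by exists (h v), b.+2; rewrite /= negbK oddb.
have phi_inj b v w : (D `\` Cb b) v -> (D `\` Cb b) w -> phi b v = phi b w -> v = w.
  move=> [Dv nv] [Dw nw]; rewrite /phi.
  case: (pselect (Cb b v)) => [//|/= _]; case: (pselect (Cb b w)) => [//|/= _].
  case: pselect => /= [[Cv _]|/(D0E _ Dv) D0v];
    case: pselect => /= [[Cw _]|/(D0E _ Dw) D0w].
  - by move=> /(jinj _ _ _ _ Cv Cw)[].
  - by move=> /(jinj _ _ _ _ Cv (hC w D0w))[_]; case: (b).
  - by move=> /(jinj _ _ _ _ (hC v D0v) Cw)[_]; case: (b).
  - by move=> /(jinj _ _ _ _ (hC v D0v) (hC w D0w))[/hinj ->].
have /choice[g gP] b := linear_extension (phi b) bD.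
have gE b v s c : [set` s] `<=` D -> v - \sum_(u <- s) c u *: u \in W' ->
    g b v = \sum_(u <- s) c u *: phi b u.
  move=> sD' vc; have [g0 gphi] := gP b.
  rewrite -[v](subrK (\sum_(x <- s) c x *: x)) linearD g0 // add0r linear_sum.
  by apply: eq_big_seq => u /sD' Du; rewrite linearZ gphi.
have gCb b v : Cb b v -> g b v = 0.
  move=> Cbv; have [g0 gphi] := gP b; have [/AW'/g0//|nAv] := pselect (A v).
  by rewrite gphi ?phi0 //; apply: ED; split=> //; exact: CbC Cbv.
have gg0 b v : g b (g b v) = 0.
  have [s [c [_ sD' vc]]] := bD.2 v.
  rewrite (gE b v s c) // linear_sum big_seq big1 // => u /sD' Du; rewrite linearZ /=.
  have [Cbu|nCbu] := pselect (Cb b u); first by rewrite phi0 // linear0 scaler0.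
  by rewrite gCb ?scaler0 //; exact: phiC.
have gW b v s c : uniq s -> [set` s] `<=` D -> v - \sum_(u <- s) c u *: u \in W' ->
    g b v \in W -> forall u, u \in s -> ~ Cb b u -> c u = 0.
  move=> us sD' vc; rewrite (gE b v s c) //.
  rewrite (bigID (fun u => `[< Cb b u >])) /= big1 ?add0r; last first.
    by move=> u /asboolP /phi0 ->; rewrite scaler0.
  rewrite -big_filter => Wc u su nCbu.
  apply: (indep_mod_inj (A := D `\` Cb b) (phi := phi b) iC _ (phi_inj b) _ _ Wc).
  - by move=> w [Dw nCbw]; exact/CbC/phiC.
  - exact: filter_uniq.
  - by move=> w /=; rewrite mem_filter => /andP[/asboolPn nw /sD'].
  - by rewrite mem_filter su andbT; exact/asboolPn.
have gnbhs b := nbhs0_preimage_square_zero (gg0 b) W0.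
apply: filterS (filterI (gnbhs false) (gnbhs true)) => v [/= g0 g1].
have [s [c [us sD' vc]]] := bD.2 v.
suff s0 : \sum_(x <- s) c x *: x = 0 by move: vc; rewrite s0 subr0.
rewrite big_seq big1 // => u su; suff -> : c u = 0 by rewrite scale0r.
(* [g false] detects every coefficient outside [Cb false]; the others lie outside [Cb true] and are
   detected by [g true]. *)
have [Cu|nCu] := pselect (Cb false u); last exact: (gW false v s c).
by apply: (gW true v s c) => //; exact: Cb_disj.
Qed.

End AutInvariant.

(** * Choice of the cardinal *)

Lemma Cantor_set (T : Type) : ~ ([set: set T] #<= [set: T]).
Proof.
move=> le; have [t0] : inhabited T.
  move: le => /card_leP/unsquash f.
  exact: (inhabits (val (f (SigSub (mem_set (I : [set: set T] set0)))))).
have [f [_ finj]] := card_le_inj_on t0 le.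
have [g gf] : exists g, forall A : set T, g (f A) = A.
  have [|g gf] := @left_inverse_on _ _ set0 setT f; first by move=> A B _ _; exact: finj.
  by exists g => A; exact: gf.
pose B := [set t | ~ g t t].
have : B (f B) <-> ~ B (f B) by rewrite {1}/B /= gf.
by tauto.
Qed.

Section HasCodimTopology.
Variables (k : fieldType) (V : discreteTvsType k).
Implicit Types (W : submodClosed V).
Hypothesis V_linear : linear_topology V.

Lemma is_codim_topology_open (K : Type) :
  (forall W, open [set` W] <-> codim_lt W K) -> is_codim_topology V K.
Proof.
move=> openE'; rewrite /is_codim_topology /generated_by_subspaces V_linear.
congr (smallest _ _); apply/seteqP.
by split=> _ [W /openE' PW <-]; exists W.
Qed.

Lemma open_nbhs0 W : open [set` W] -> nbhs (0 : V) [set` W].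
Proof. by move=> Wo; apply: open_nbhs_nbhs; split=> //=; exact: rpred0. Qed.

Lemma Aut_has_codim_topology : Aut V = CAut V -> has_codim_topology V.
Proof.
move=> AutE.
have Aut_nbhs0 (f : {linear V -> V}) (A : set V) : bijective f ->
    nbhs (0 : V) A -> nbhs (0 : V) (f @^-1` A).
  move=> fbij A0; have : CAut V f by rewrite -AutE.
  by move=> [_ fcont]; apply: (fcont 0); rewrite linear0.
have [[W0 [W0o [u nW0u]]]|full] :=
    pselect (exists W, open [set` W] /\ exists u, u \notin W); last first.
  (* If only [V] is open, the cardinal is 1: codimension below 1 means an empty basis. *)
  exists unit; split; first by left; exact: card_eqxx.
  apply: is_codim_topology_open => W; rewrite codim_ltP; split=> [Wo|[D [bD _ D0]]].
    exists set0; split; last 2 first.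
    - exact: card_ge0.
    - by move/card_le0P => /seteqP[/(_ tt I)].
    split=> [s c _ s0 _ v /s0//|v]; apply: span_mod_sub.
    by apply: contrapT => /negP nWv; apply: full; exists W; split=> //; exists v.
  suff -> : [set` W] = setT by exact: openT.
  apply/seteqP; split=> // v _ /=; have [s [c [_ sD vc]]] := bD.2 v.
  move: vc; rewrite big_seq big1 ?subr0 // => x /sD Dx; case: D0.
  by apply: (inj_on_card_le (f := fun=> x)) => // -[] [].
(* Candidate cardinals are realized as subsets of one type. By Cantor its power set construction
   exceeds the size of every basis in [V], and the summand [nat] makes it infinite, so the family is
   nonempty. *)
pose X := set (V + nat).
pose fam := {S : set X | infinite_set S /\ forall W, open [set` W] -> codim_lt W S}.
have famT : infinite_set [set: X] /\ forall W, open [set` W] -> codim_lt W [set: X].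
  have inj_set (T : Type) (i : T -> V + nat) (A : set T) : injective i -> A #<= [set: X].
    move=> i_inj; apply: (inj_on_card_le (f := fun t => [set i t])) => // x y _ _.
    by move=> /seteqP[/(_ (i x) erefl)/i_inj].
  split; first by apply/infiniteP; apply: (inj_set _ inr) => x y [].
  move=> W _; have [D bD] := basis_mod_exists W; apply/codim_ltP; exists D.
  rewrite (card_le_eqr (card_setT _)) (card_le_eql (card_setT _)); split=> //.
    by apply: (inj_set _ inl) => x y [].
  move=> XD; apply: (@Cantor_set (V + nat)); apply: (card_le_trans XD).
  by apply: (inj_on_card_le (f := inl)) => // x y _ _ [].
have [[S [Sinf SW]] Smin] := card_le_min (exist _ setT famT : fam) (fun S => sval S).
exists S; split.
  by right; rewrite (card_le_eqr (card_setT _)); exact/infiniteP.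
apply: is_codim_topology_open => W; split=> [|/codim_ltP[D [bD DS SD]]]; first exact: SW.
rewrite (card_le_eqr (card_setT _)) in DS; rewrite (card_le_eql (card_setT _)) in SD.
apply: nbhs0_open; have [Dfin|Dinf] := pselect (finite_set D).
  exact (nbhs0_finite_codim Aut_nbhs0 (open_nbhs0 W0o) nW0u bD Dfin).
(* [D] is copied into [X], so that it can be compared with members of the family. *)
have [h [_ hinj]] := card_le_inj_on set0 DS.
have hD : h @` D #= D.
  by apply: inj_card_eq => x y /set_mem Dx /set_mem Dy; exact: hinj.
have [W1 W1o nW1] : exists2 W1 : submodClosed V, open [set` W1] & ~ codim_lt W1 (h @` D).
  apply: contrapT => nW1; apply: SD.
  have famD : infinite_set (h @` D) /\ forall W, open [set` W] -> codim_lt W (h @` D).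
    split=> [|W1 W1o]; first by rewrite (eq_finite_set hD).
    by apply: contrapT => ?; apply: nW1; exists W1.
  by have /= := Smin (exist _ _ famD); rewrite (card_le_eqr hD).
apply: (nbhs0_infinite_codim Aut_nbhs0 (open_nbhs0 W1o) bD Dinf) => C bC.
apply: contrapT => nDC; have [//|CD] := card_le_total D C.
apply: nW1; apply/codim_ltP; exists C; split=> //.
  by rewrite (card_le_eqr (card_setT _)) (card_le_eqr hD).
by rewrite (card_le_eql (card_setT _)) (card_le_eql hD).
Qed.

End HasCodimTopology.

Theorem theorem2p12 (k : fieldType) (V : discreteTvsType k)
    (hV : linear_topology V) :
  has_codim_topology V <-> Aut V = CAut V.
Proof.
by split; [exact: codim_topology_Aut | exact: Aut_has_codim_topology].
Qed.
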